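(* Let $n\ge1$, $\alpha>1$, and let $(p_A)_{A\subset[n]}$ be a probability distribution on subsets of $[n]$ with $p_\varnothing=0$. Suppose there exist numbers $(p_\ell)_{\ell=1}^n$ and $(a_\ell)_{\ell=1}^n$ such that for every $m\in\{1,\dots,n\}$: (i) $p_A\in\{0,p_m\}$ whenever $|A|=m$; and (ii) $\#\{A\ni i:|A|=m,\ p_A=p_m\}=a_m$ for every $i\in[n]$. Then $\vec 1/n=(1/n,\dots,1/n)$ is an equilibrium of the WARM with $W(x)=x^\alpha$ and subset law $(p_A)$, i.e. $\vec 1/n\in\mathcal E_\alpha$.
   Context: $[n]=\{1,\dots,n\}$ and $\Delta_n=\{\vec u\in\mathbb R^n:u_i\ge0,\ \sum_i u_i=1\}$. A WARM is the urn model in which at each time a random subset $A$ of the $n$ colours is chosen (i.i.d., with probability $p_A$), and then a colour $i\in A$ is selected with probability proportional to $W$(current number of balls of colour $i$) and a ball of that colour is added. An equilibrium ($\vec v\in\mathcal E_\alpha$) is a $\vec v\in\Delta_n$ with $F(\vec v)=\vec 0$, where $F(\vec v)_i=-v_i+\sum_{A\ni i}p_A\,\frac{v_i^\alpha}{\sum_{j\in A}v_j^\alpha}$ (with $0/0$ read as $0$). *)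

(* Defs.v *)
From mathcomp Require Import all_boot all_order all_algebra.
From mathcomp Require Import classical_sets reals exp.

Set Implicit Arguments.
Unset Strict Implicit.
Unset Printing Implicit Defensive.

Import Order.TTheory GRing.Theory Num.Theory.
Local Open Scope ring_scope.

Definition prob_dist (R : realType) (T : finType) (p : T -> R) : Prop :=
  (forall x, 0 <= p x) /\ \sum_x p x = 1.

Definition std_simplex (R : realType) (n : nat) : set 'rV[R]_n :=
  [set u | (forall i, 0 <= u 0 i) /\ \sum_i u 0 i = 1]%classic.

(* The drift of the WARM with W(x) = x^alpha and subset law p. Colours are
   indexed from 0. For alpha > 0, 0 `^ alpha = 0, and x / 0 = 0 in MathComp, so
   the convention 0/0 = 0 holds. *)
Definition warm_drift (R : realType) (n : nat) (p : {set 'I_n} -> R) (alpha : R)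
    (v : 'rV[R]_n) : 'rV[R]_n :=
  \row_i (- v 0 i + \sum_(A : {set 'I_n} | i \in A)
            p A * (v 0 i `^ alpha / \sum_(j in A) v 0 j `^ alpha)).

Definition warm_equilibria (R : realType) (n : nat) (p : {set 'I_n} -> R)
    (alpha : R) : set 'rV[R]_n :=
  [set v | std_simplex v /\ warm_drift p alpha v = 0]%classic.

(* Main.v *)
(* At the barycentre every colour of A is selected with probability 1/|A|, so
   colour i is selected with total probability S_i = sum_(A containing i) p_A / |A|.
   Grouping by m = |A| gives S_i = sum_m a_m p_m / m, which does not depend on i;
   since the S_i sum to 1, each of them is 1/n. *)
Require Import Defs.
From mathcomp Require Import all_boot all_order all_algebra.
From mathcomp Require Import reals exp.

Set Implicit Arguments.
Unset Strict Implicit.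
Unset Printing Implicit Defensive.

Import Order.TTheory GRing.Theory Num.Theory.
Local Open Scope ring_scope.

(** In each ratio the common power of [c] cancels; it is nonzero because [c > 0]. *)
Lemma warm_drift_const (R : realType) (n : nat) (p : {set 'I_n} -> R)
    (alpha c : R) (i : 'I_n) : 0 < c ->
  warm_drift p alpha (const_mx c) 0 i
  = - c + \sum_(A : {set 'I_n} | i \in A) p A / #|A|%:R.
Proof.
move=> c_gt0; rewrite !mxE; congr (_ + _); apply: eq_bigr => A _.
under eq_bigr do rewrite mxE.
have pow_neq0 : c `^ alpha != 0 by rewrite gt_eqF// powR_gt0.
congr (_ * _); rewrite sumr_const -[_ *+ _]mulr_natl invfM mulrCA.
by rewrite divff// mulr1.
Qed.

(** Double counting: [A] contributes [p A / #|A|] once per element. The empty set adds nothing on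
    the left, hence [p set0 = 0]. *)
Lemma sum_selection (R : realType) (n : nat) (p : {set 'I_n} -> R) :
  p set0 = 0 ->
  \sum_(i < n) \sum_(A : {set 'I_n} | i \in A) p A / #|A|%:R = \sum_A p A.
Proof.
move=> p0; rewrite (exchange_big_dep xpredT)//=; apply: eq_bigr => A _.
rewrite sumr_const -[_ *+ _]mulr_natr.
have [->|A_neq0] := eqVneq A set0; first by rewrite p0 !mul0r.
by rewrite divfK// pnatr_eq0 cards_eq0.
Qed.

Lemma selection_symmetric (R : realType) (n : nat) (p : {set 'I_n} -> R)
    (q : nat -> R) (a : nat -> nat) (i : 'I_n) :
  (forall m : nat, (1 <= m <= n)%N ->
     (forall A : {set 'I_n}, #|A| = m -> p A = 0 \/ p A = q m) /\
     (forall i : 'I_n,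
        #|[set A : {set 'I_n} | [&& i \in A, #|A| == m & p A == q m]]| = a m)) ->
  \sum_(A : {set 'I_n} | i \in A) p A / #|A|%:R
  = \sum_(1 <= m < n.+1) (q m / m%:R) *+ a m.
Proof.
move=> pP.
(* A sum with the single index [m = #|A|] lets the exchange of sums group the sets by size;
   [i \in A] keeps [m] at least 1. *)
have by_card (A : {set 'I_n}) : i \in A ->
    p A / #|A|%:R = \sum_(1 <= m < n.+1 | m == #|A|) p A / m%:R.
  move=> iA; rewrite (big_nat1_eq _ (fun m => p A / m%:R)).
  have /card_gt0P-> : exists j, j \in A by exists i.
  by rewrite ltnS -[X in (_ <= X)%N]card_ord max_card.
rewrite (eq_bigr _ by_card) (exchange_big_dep xpredT)//=.
rewrite big_nat [RHS]big_nat.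
apply: eq_bigr => m; rewrite ltnS => /pP[p_cases /(_ i) <-].
(* The multiple by [a m], now a cardinal, is spread back into a sum over the counted sets. *)
rewrite -(sumr_const (mem (finset _))).
(* Sets of size [m] with [p A != q m] have [p A = 0] and drop out; if [q m = 0] there are none. *)
rewrite (bigID (fun A => p A == q m))/= addrC big1 ?add0r.
  by apply: eq_big => [A|A /andP[_ /eqP->]//]; rewrite inE andbA eq_sym.
by move=> A /andP[/andP[_ /eqP/esym/p_cases[->|->]]]; rewrite ?mul0r// eqxx.
Qed.

Theorem lemma1p17 (R : realType) (n : nat) (alpha : R) (p : {set 'I_n} -> R) :
  (1 <= n)%N ->
  1 < alpha ->
  prob_dist p ->
  p set0 = 0 ->
  (exists (q : nat -> R) (a : nat -> nat),
     forall m : nat, (1 <= m <= n)%N ->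
       (forall A : {set 'I_n}, #|A| = m -> p A = 0 \/ p A = q m) /\
       (forall i : 'I_n,
          #|[set A : {set 'I_n} | [&& i \in A, #|A| == m & p A == q m]]| = a m)) ->
  warm_equilibria p alpha (const_mx (n%:R^-1)).
Proof.
move=> n_gt0 _ [_ sum_p] p0 [q [a pP]].
have n_neq0 : n%:R != 0 :> R by rewrite pnatr_eq0 -lt0n.
have ninv_gt0 : 0 < n%:R^-1 :> R by rewrite invr_gt0 ltr0n.
split; first split => [i|]; first by rewrite mxE ltW.
  under eq_bigr do rewrite mxE.
  by rewrite sumr_const card_ord -[_ *+ _]mulr_natl divff.
apply/rowP => i; rewrite warm_drift_const// mxE (selection_symmetric i pP).
have := sum_selection p0; under eq_bigr do rewrite (selection_symmetric _ pP).
rewrite sum_p sumr_const card_ord -[_ *+ _]mulr_natl => S1.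
(* [S1] says that [n] times the common selection probability is 1. *)
by rewrite -[X in _ + X](mulKf n_neq0) S1 mulr1 addNr.
Qed.
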